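(* Consider the quantized self-triggered multi-agent system described in the context. Let upper bounds $\tau^i_{\max}>0$ be given, and assume: (a) $\delta_i+\dfrac{d_i}{R}<\dfrac{\gamma}{2\Gamma_\infty}$ for all $i\in\mathcal{N}$; (b) $0<\tau^i_{\min}\le\min\{\tilde\tau^i_{\min},\tau^i_{\max}\}$ for all $i\in\mathcal{N}$; (c) $0<\omega\le\tilde\omega$. Then the unsaturation condition $|x_i(t_k^i)-x_j(t_k^i)|\le E(t_k^i)$ holds for all $j\in\mathcal{N}_i$, $k\in\mathbb{N}_0$, $i\in\mathcal{N}$ (so all quantizer arguments lie in the quantization region), and \[ |x_i(t)-x_j(t)|\le 2\Gamma_\infty E_0e^{-\omega t}\qquad\text{for all } t\ge0,\ i,j\in\mathcal{N}; \] that is, the system achieves consensus exponentially with decay rate $\omega$ (with constant $2\Gamma_\infty$ independent of $E_0$).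
   Context: Setting. $N\ge2$ agents indexed by $\mathcal{N}=\{1,\dots,N\}$ communicate over a connected undirected graph $G$; $\mathcal{N}_i$ is the set of neighbors of agent $i$, $d_i=|\mathcal{N}_i|$, and $L$ is the graph Laplacian. $\mathbf{1}=(1,\dots,1)^\top$, $\bar{\mathbf{1}}=\frac1N\mathbf{1}^\top$, $\|\cdot\|_\infty$ is the maximum norm (and induced matrix norm), $\lambda_2(L)$ the second smallest eigenvalue of $L$, and $W$ the Lambert $W$-function on $[0,\infty)$ ($W(y)$ is the solution $x\ge0$ of $xe^x=y$). $\inf\emptyset=\infty$. Dynamics: $\dot x_i(t)=u_i(t)$, $x_i(0)=x_{i0}\in\mathbb{R}$. A constant $E_0>0$ satisfies $|x_{i0}-\frac1N\sum_{j}x_{j0}|\le E_0$ for all $i$. The number of quantization levels is $R=2R_0+1$ with $R_0\in\mathbb{N}_0$. Fix $0<\gamma\le\lambda_2(L)$ and $\Gamma_\infty:=\sup_{t\ge0}\|e^{\gamma t}(e^{-Lt}-\mathbf{1}\bar{\mathbf{1}})\|_\infty$ (finite). For $\omega>0$ define the quantization range $E(t):=2\Gamma_\infty E_0e^{-\omega t}$. Quantizer: for $E>0$ and $z\in[-E,E]$, $Q_{E,R}[z]=2pE/R$ if $(2p-1)E/R<z\le(2p+1)E/R$ with $p\in\{1,\dots,R_0\}$, $Q_{E,R}[z]=0$ if $|z|\le E/R$, and $Q_{E,R}[z]=-Q_{E,R}[-z]$ if $z<-E/R$. Sampling and control: each agent $i$ has parameters $\delta_i>0$, $0<\tau^i_{\min}\le\tau^i_{\max}$,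 and sampling times $t_0^i=0<t_1^i<\dots$. For $t_k^i\le t<t_{k+1}^i$, $u_i(t)=-q_i(t_k^i)$, where $q_i(t_k^i)=\sum_{j\in\mathcal{N}_i}Q_{E(t_k^i),R}[x_i(t_k^i)-x_j(t_k^i)]$. The next sampling time is $t_{k+1}^i=t_k^i+\min\{\tau_k^i,\tau^i_{\max}\}$ with \[ \tau_k^i=\inf\{\tau\ge\tau^i_{\min}: |f_k^i(\tau)|\ge\delta_iE(t_k^i+\tau)\},\qquad f_k^i(\tau)=\sum_{j\in\mathcal{N}_i}\int_{t_k^i}^{t_k^i+\tau}(u_i(s)-u_j(s))\,ds. \] Auxiliary constants: \[ \tilde\tau^i_{\min}:=\frac1\omega W\!\left(\frac{\omega\delta_i}{d_i^2+\sum_{j\in\mathcal{N}_i}d_je^{\omega\tau^j_{\max}}}\right),\qquad \tilde\omega:=\min_{i\in\mathcal{N}}\left(\eta_i-\frac{W(\xi_i\tau^i_{\max}e^{\eta_i\tau^i_{\max}})}{\tau^i_{\max}}\right), \] with $\xi_i:=2\Gamma_\infty d_i/R$ and $\eta_i:=\gamma-2\Gamma_\infty\delta_i$. *)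

(* Defs.v *)
From HB Require Import structures.
From mathcomp Require Import all_boot all_order all_algebra.
From mathcomp Require Import all_classical all_reals all_analysis.
Set Implicit Arguments. Unset Strict Implicit. Unset Printing Implicit Defensive.
Import Order.TTheory GRing.Theory Num.Theory.
Import numFieldNormedType.Exports.
Local Open Scope classical_set_scope.
Local Open Scope ring_scope.

Section Defs.
Variable R : realType.

Definition undirected_graph (N : nat) (adj : rel 'I_N) : Prop :=
  (forall i j, adj i j = adj j i) /\ (forall i, ~~ adj i i).
Definition connected_graph (N : nat) (adj : rel 'I_N) : Prop :=
  forall i j, connect adj i j.
Definition deg (N : nat) (adj : rel 'I_N) (i : 'I_N) : nat := #|[set j | adj i j]|.
Definition laplacian (N : nat) (adj : rel 'I_N) : 'M[R]_N :=
  \matrix_(i, j) (if i == j then (deg adj i)%:R else if adj i j then -1 else 0).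

Definition mexp (n : nat) (A : 'M[R]_n) : 'M[R]_n :=
  \matrix_(i, j) limn (fun m : nat => \sum_(k < m) (A ^+ k) i j / (k`!)%:R).
Definition mxnorm_inf (n : nat) (A : 'M[R]_n) : R :=
  \big[Num.max/0]_(i < n) \sum_(j < n) `|A i j|.
Definition avg_mx (n : nat) : 'M[R]_n := \matrix_(i, j) (n%:R)^-1.
(* lambda2 A = l : l is the second smallest eigenvalue of A, counted with
   algebraic multiplicity (for a real symmetric A, char_poly A splits over R) *)
Definition is_lambda2 (n : nat) (A : 'M[R]_n) (l : R) : Prop :=
  exists s : seq R, [/\ sorted <=%R s,
                        char_poly A = \prod_(a <- s) ('X - a%:P) & l = s`_1].
Definition Gamma_inf (n : nat) (L : 'M[R]_n) (gamma : R) : R :=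
  sup [set r | exists2 t : R, 0 <= t &
        r = mxnorm_inf (expR (gamma * t) *: (mexp ((- t) *: L) - avg_mx n))].

Definition lambertW (y : R) : R := xget 0 [set x : R | 0 <= x /\ x * expR x = y].

(* literal transcription of the case definition on [-E, E]:
   positive branch, zero on [-E/R, E/R], odd extension. (Outside [-E,E] the
   paper leaves Q undefined; this expression gives 0 there.) *)
Definition quant (R0 : nat) (E z : R) : R :=
  let Rl := (2 * R0 + 1)%:R in
  let pos w := \sum_(1 <= p < R0.+1)
      (if ((2 * p - 1)%:R * E / Rl < w) && (w <= (2 * p + 1)%:R * E / Rl)
       then (2 * p)%:R * E / Rl else 0) in
  if z < - (E / Rl) then - pos (- z) else pos z.

Definition leb_int (a b : R) (f : R -> R) : R :=
  Rintegral (@lebesgue_measure R) `[a, b] f.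

Definition Erange (Gam E0 omega t : R) : R := 2 * Gam * E0 * expR (- (omega * t)).

Definition is_trajectory (N : nat) (adj : rel 'I_N) (R0 : nat)
    (Gam E0 omega : R) (x0 delta taumin taumax : 'I_N -> R)
    (x u : 'I_N -> R -> R) (tk : 'I_N -> nat -> R) : Prop :=
  let E := Erange Gam E0 omega in
  let q i k := \sum_(j | adj i j) quant R0 (E (tk i k)) (x i (tk i k) - x j (tk i k)) in
  let f i k tau := \sum_(j | adj i j)
        leb_int (tk i k) (tk i k + tau) (fun s => u i s - u j s) in
  [/\
      (forall i t, 0 <= t -> x i t = x0 i + leb_int 0 t (u i)),
      (forall i k s, tk i k <= s < tk i k.+1 -> u i s = - q i k),
      (forall i, tk i 0 = 0) &
      (forall i k, tk i k.+1 = tk i k +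
         fine (Order.min
           (ereal_inf [set tau%:E | tau in
              [set tau : R | taumin i <= tau /\ delta i * E (tk i k + tau) <= `|f i k tau|]])
           (taumax i)%:E))].

Definition tilde_taumin (N : nat) (adj : rel 'I_N) (omega : R)
    (delta taumax : 'I_N -> R) (i : 'I_N) : R :=
  omega^-1 * lambertW (omega * delta i /
     ((deg adj i)%:R ^+ 2 + \sum_(j | adj i j) (deg adj j)%:R * expR (omega * taumax j))).

Definition tilde_omega_term (N : nat) (adj : rel 'I_N) (R0 : nat) (Gam gamma : R)
    (delta taumax : 'I_N -> R) (i : 'I_N) : R :=
  let xi := 2 * Gam * (deg adj i)%:R / (2 * R0 + 1)%:R in
  let eta := gamma - 2 * Gam * delta i in
  eta - lambertW (xi * taumax i * expR (eta * taumax i)) / taumax i.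

End Defs.

(* Main.v *)
Require Import Defs.
From HB Require Import structures.
From mathcomp Require Import all_boot all_order all_algebra.
From mathcomp Require Import all_classical all_reals all_analysis.
From mathcomp Require Import ring lra.
Import Order.TTheory GRing.Theory Num.Theory.
Import numFieldNormedType.Exports.
Set Implicit Arguments. Unset Strict Implicit. Unset Printing Implicit Defensive.
Local Open Scope classical_set_scope.
Local Open Scope ring_scope.

(** Write the input as [u = - L x + e].  Between two samples of agent [i] the
    error [e_i] is the sum of the drift of [(L x)_i], which the triggering rule
    keeps below [delta_i E], and of the quantization error, which is at most
    [d_i E(t_k) / R] when the samples are unsaturated.  The condition on [omega]
    says exactly that the resulting bound on [e] is at most
    [(gamma - omega) E0 exp (- omega s)].  Variation of constants together with
    [|exp (- L t) - 1 1bar| <= Gamma exp (- gamma t)] then gives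
    [|x - mean| <= Gamma E0 exp (- omega t)], hence the consensus bound at [t].
    Only samples taken strictly before [t] enter this argument, and there are
    finitely many of them, so unsaturation follows by induction on time. *)

(** * Matrix exponential *)

Section MatrixExponential.
Context {R : realType} {n : nat}.
Implicit Types (A : 'M[R]_n) (i j : 'I_n).

Lemma expr_scalemx A (a : R) k : (a *: A) ^+ k = a ^+ k *: A ^+ k.
Proof.
elim: k => [|k IH]; first by rewrite !expr0 scale1r.
rewrite !exprS IH -[LHS]/((a *: A) *m (a ^+ k *: A ^+ k)).
by rewrite -scalemxAl -scalemxAr scalerA.
Qed.

(** Entrywise l1 norm. It dominates every column sum, which is what the induction on powers of [A]
    needs. *)
Definition mx_abs_sum A : R := \sum_i \sum_j `|A i j|.

Lemma norm_expr_mx_le A i j k : `|(A ^+ k) i j| <= mx_abs_sum A ^+ k.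
Proof.
have colle l : \sum_i `|A i l| <= mx_abs_sum A.
  apply: ler_sum => i' _; rewrite (bigD1 l)//= lerDl; exact: sumr_ge0.
have M0 : 0 <= mx_abs_sum A by do 2 (apply: sumr_ge0 => ? _).
elim: k i j => [|k IH] i j.
  by rewrite !expr0 mxE; case: eqP; rewrite ?normr1 ?normr0.
rewrite !exprSr -[A ^+ k * A]/(A ^+ k *m A) mxE.
apply: (le_trans (ler_norm_sum _ _ _)).
apply: (@le_trans _ _ (\sum_l mx_abs_sum A ^+ k * `|A l j|)).
  by apply: ler_sum => l _; rewrite normrM ler_wpM2r.
by rewrite -mulr_sumr ler_wpM2l// exprn_ge0.
Qed.

(** Coefficients in [z] of the entry [(i, j)] of [A ^+ m * exp (z A)]. The shift [m] closes the
    family under formal differentiation, which turns [m] into [m + 1]. *)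
Definition mexp_coef A i j (m k : nat) : R := (A ^+ (k + m)) i j / k`!%:R.

Lemma is_cvg_mexp_coef A i j m (z : R) : cvgn (pseries (mexp_coef A i j m) z).
Proof.
have M0 : 0 <= mx_abs_sum A by do 2 (apply: sumr_ge0 => ? _).
apply: normed_cvg.
(* The majorant is the scalar exponential series at [mx_abs_sum A * |z|], scaled by
   [mx_abs_sum A ^+ m]. *)
apply: (@series_le_cvg _ _
  (fun k => mx_abs_sum A ^+ m * exp_coeff (mx_abs_sum A * `|z|) k)) => //=.
- move=> k; rewrite mulr_ge0 ?exprn_ge0// exp_coeff_ge0// mulr_ge0//.
- move=> k; rewrite /mexp_coef /exp_coeff/= !normrM normfV normrX.
  rewrite (ger0_norm (ler0n _ _)) exprMn.
  rewrite [leRHS](_ : _ = mx_abs_sum A ^+ (k + m) / k`!%:R * `|z| ^+ k); last first.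
    by rewrite exprD; ring.
  by rewrite ler_wpM2r ?exprn_ge0// ler_wpM2r ?invr_ge0// norm_expr_mx_le.
- exact: (is_cvg_seriesZ (is_cvg_series_exp_coeff _)).
Qed.

Lemma mexpZ_pseries A (z : R) i j :
  mexp (z *: A) i j = limn (pseries (mexp_coef A i j 0) z).
Proof.
rewrite mxE /pseries; congr (lim (_ @ \oo)).
apply/funext => m; rewrite /series/= big_mkord; apply: eq_bigr => k _.
by rewrite expr_scalemx mxE /mexp_coef addn0; ring.
Qed.

Lemma cvg_mexp A (z : R) i j :
  pseries (mexp_coef A i j 0) z @ \oo --> mexp (z *: A) i j.
Proof. by rewrite mexpZ_pseries; exact: is_cvg_mexp_coef. Qed.

Lemma pseries_diffs_mexp_coef A i j m :
  pseries_diffs (mexp_coef A i j m) = mexp_coef A i j m.+1.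
Proof.
apply/funext => k; rewrite /pseries_diffs /mexp_coef addSnnS factS natrM.
by rewrite invfM mulrCA mulVKf// pnatr_eq0.
Qed.

Lemma lim_pseries_mexp_coef1 A (z : R) i j :
  limn (pseries (mexp_coef A i j 1) z) = (mexp (z *: A) *m A) i j.
Proof.
apply/cvg_lim => //; rewrite mxE.
rewrite (_ : pseries _ z =
  fun m => \sum_l pseries (mexp_coef A i l 0) z m * A l j).
  apply: cvg_big => [|l _]; first exact: add_continuous.
  by apply: cvgMr_tmp; exact: cvg_mexp.
apply/funext => m; rewrite /pseries/series/=.
under [RHS]eq_bigr do rewrite mulr_suml.
rewrite exchange_big/=; apply: eq_bigr => k _.
rewrite /mexp_coef addn1 exprSr -[A ^+ k * A]/(A ^+ k *m A) mxE !mulr_suml.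
by apply: eq_bigr => l _; rewrite addn0; ring.
Qed.

Lemma is_derive_mexp A i j (z : R) :
  is_derive z (1 : R) (fun y => mexp (y *: A) i j) ((mexp (z *: A) *m A) i j).
Proof.
rewrite (_ : (fun y => _) = (fun y => limn (pseries (mexp_coef A i j 0) y))).
  rewrite -lim_pseries_mexp_coef1 -pseries_diffs_mexp_coef.
  (* The series converge everywhere, so any radius beyond [|z|] allows termwise differentiation. *)
  apply: (@pseries_snd_diffs _ _ (`|z| + 1));
    rewrite ?pseries_diffs_mexp_coef; try exact: is_cvg_mexp_coef.
  by rewrite [ltRHS]ger0_norm ?ltrDl// addr_ge0.
by apply/funext => y; rewrite mexpZ_pseries.
Qed.

Lemma mexp0 : mexp (0 : 'M[R]_n) = 1%:M.
Proof.
apply/matrixP => i j; rewrite mxE; apply/cvg_lim => //.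
(* The empty partial sum is 0; the sequence is constant only from index 1 on. *)
rewrite -cvg_shiftS (_ : (fun m => _) = cst ((1%:M : 'M[R]_n) i j)).
  exact: cvg_cst.
apply/funext => m; rewrite big_ord_recl/= expr0 fact0 divr1 big1 ?addr0//.
by move=> k _; rewrite exprS -[0 * _]/(0 *m _) mul0mx mxE mul0r.
Qed.

Lemma ler_sum_mxnorm_inf A i : \sum_j `|A i j| <= mxnorm_inf A.
Proof. by rewrite /mxnorm_inf; apply: le_bigmax. Qed.

End MatrixExponential.

(** * Lambert function and quantizer *)

Section LambertQuantizer.
Context {R : realType}.

(** Since [0 <= y <= y * expR y], the intermediate value theorem on [[0, y]] gives a solution, so
    [xget] does not return its default. *)
Lemma lambertWP (y : R) :
  0 <= y -> 0 <= lambertW y /\ lambertW y * expR (lambertW y) = y.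
Proof.
move=> y0; apply: (@xgetPex _ 0 [set x : R | 0 <= x /\ x * expR x = y]).
have ybound : y <= y * expR y by rewrite ler_peMr// -expR0 ler_expR.
have [] := @IVT R (fun x => x * expR x) 0 y y y0.
- apply: continuous_subspaceT => x; apply: continuousM; first exact: cvg_id.
  exact: continuous_expR.
- by rewrite mul0r ge_min y0/= le_max ybound orbT.
- by move=> c; rewrite in_itv/= => /andP[c0 _] cy; exists c.
Qed.

Lemma ler_mul_expR (a b : R) : 0 <= a -> a <= b -> a * expR a <= b * expR b.
Proof. by move=> a0 ab; rewrite ler_pM// ?expR_ge0// ler_expR. Qed.

(** Positive branch of the quantizer with [n] levels, where [h = E / R] is half the width of a
    cell. *)
Definition quant_pos (n : nat) (h w : R) : R := \sum_(1 <= p < n.+1)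
  (if ((2 * p - 1)%:R * h < w) && (w <= (2 * p + 1)%:R * h)
   then (2 * p)%:R * h else 0).

Lemma quant_posS n (h w : R) : quant_pos n.+1 h w = quant_pos n h w +
  (if (n.*2.+1%:R * h < w) && (w <= n.*2.+3%:R * h) then n.*2.+2%:R * h else 0).
Proof.
rewrite /quant_pos big_nat_recr//=.
have -> : (2 * n.+1 - 1)%N = n.*2.+1 by rewrite mul2n doubleS subn1.
by rewrite mul2n doubleS addn1.
Qed.

Lemma quant_pos_le (n : nat) (h w : R) : 0 < h -> w <= h -> quant_pos n h w = 0.
Proof.
move=> h0 wh; elim: n => [|n IH]; first by rewrite /quant_pos big_geq.
rewrite quant_posS IH add0r ifF//; apply/negbTE; rewrite negb_and -leNgt.
by apply/orP; left; rewrite (le_trans wh)// ler_peMl ?ler1n// ltW.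
Qed.

Lemma quant_pos_gt (n : nat) (h w : R) :
  0 < h -> n.*2.+1%:R * h < w -> quant_pos n h w = 0.
Proof.
move=> h0; elim: n => [|n IH] wh; first by rewrite /quant_pos big_geq.
rewrite quant_posS IH ?add0r; last first.
  by apply: le_lt_trans wh; rewrite ler_pM2r// ler_nat ?ltnS leq_double.
by rewrite ifF//; apply/negbTE; rewrite negb_and -!ltNge wh orbT.
Qed.

(** Induction on the number of levels: a point beyond the first [n] cells gets no contribution from
    them and lies within [h] of the new centre [(2n + 2) h]. *)
Lemma quant_pos_err (n : nat) (h w : R) : 0 < h -> - h <= w ->
  w <= n.*2.+1%:R * h -> `|w - quant_pos n h w| <= h.
Proof.
move=> h0 hw; elim: n => [|n IH] wh.
  by rewrite quant_pos_le// ?subr0 ?ler_norml ?hw//; rewrite mul1r in wh.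
rewrite quant_posS; have [wle|wgt] := leP w (n.*2.+1%:R * h).
  by rewrite /= addr0 IH.
rewrite /= wh quant_pos_gt// add0r ler_norml.
move: wh wgt; rewrite doubleS -!natr1 => wh wgt.
by apply/andP; split; lra.
Qed.

Lemma quant_pos_bound (n : nat) (h w : R) : 0 < h ->
  `|quant_pos n h w| <= n.*2%:R * h.
Proof.
move=> h0; elim: n => [|n IH]; first by rewrite /quant_pos big_geq// normr0 mul0r.
rewrite quant_posS; case: ifPn => [/andP[wgt _]|_].
  by rewrite quant_pos_gt// add0r ger0_norm// mulr_ge0// ltW.
by rewrite addr0 (le_trans IH)// ler_pM2r// ler_nat ?ltnS leq_double.
Qed.

Lemma quantE (R0 : nat) (E z : R) : let h := E / (2 * R0 + 1)%:R in
  quant R0 E z = if z < - h then - quant_pos R0 h (- z) else quant_pos R0 h z.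
Proof.
by rewrite /quant /quant_pos/=; case: ifP => _; [congr (- _)|];
  apply: eq_bigr => p _; rewrite !mulrA.
Qed.

Lemma quant_err (R0 : nat) (E z : R) : 0 < E -> `|z| <= E ->
  `|z - quant R0 E z| <= E / (2 * R0 + 1)%:R.
Proof.
move=> E0 zE; rewrite quantE; set h := E / _.
have Rl0 : 0 < (2 * R0 + 1)%:R :> R by rewrite ltr0n addn1.
have h0 : 0 < h by rewrite divr_gt0.
have hE : R0.*2.+1%:R * h = E.
  by rewrite /h mul2n addn1 mulrC mulfVK// pnatr_eq0.
move: zE; rewrite ler_norml => /andP[zl zu].
case: ltP => zh; last by rewrite quant_pos_err// hE.
by rewrite opprK -normrN opprD quant_pos_err// ?hE; lra.
Qed.

(** Saturated arguments are covered too, so inputs can be bounded before unsaturation is known. *)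
Lemma quant_bound (R0 : nat) (E z : R) : 0 < E -> `|quant R0 E z| <= E.
Proof.
move=> E0; rewrite quantE; set h := E / _.
have h0 : 0 < h by rewrite divr_gt0// ltr0n addn1.
have hE : R0.*2%:R * h <= E.
  rewrite /h mulrC mulrAC ler_pdivrMr ?ltr0n ?addn1// ler_pM2l// ler_nat.
  by rewrite mul2n.
by case: ltP => _; rewrite ?normrN (le_trans _ hE)// quant_pos_bound.
Qed.

End LambertQuantizer.

(** * Piecewise constant functions *)

Section Pieces.
Context {R : realType}.
Implicit Types (S : seq R) (a b c : R).

Definition misses S a b := all (fun s => ~~ (a < s < b)) S.

(** Induction on [S]: an interval with the head of the list in its interior is cut there, and both
    halves then miss that point. *)
Lemma itv_split_ind (T : R) S (P : R -> R -> Prop) :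
  (forall a b c, 0 <= a -> a < b -> b < c -> c <= T -> P a b -> P b c -> P a c) ->
  (forall a b, 0 <= a -> a <= b -> b <= T -> misses S a b -> P a b) ->
  forall a b, 0 <= a -> a <= b -> b <= T -> P a b.
Proof.
move=> Ptrans; elim: S => [|s S IH] Pmiss; first by move=> *; exact: Pmiss.
apply: IH => a b a0 ab bT mS.
have sub u v : a <= u -> v <= b -> misses S u v.
  move=> au vb; apply: sub_all mS => r /=; apply: contraNN => /andP[ur rv].
  by rewrite (le_lt_trans au ur) (lt_le_trans rv vb).
case/boolP: (a < s < b) => [/andP[as_ sb]|ns]; last first.
  by apply: Pmiss => //=; rewrite /misses/= ns.
have sT := le_trans (ltW sb) bT.
have s0 := le_trans a0 (ltW as_).
apply: (Ptrans _ s) => //; apply: Pmiss => //; try exact: ltW.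
  by rewrite /misses/= ltxx andbF/=; apply: sub; rewrite // ltW.
by rewrite /misses/= ltxx/=; apply: sub; rewrite // ltW.
Qed.

(** Induction on the number of entries of [S] below [t]: passing to an entry [s < t] loses at least
    [s] itself. *)
Lemma strong_ind_before (T : R) S (A : R -> Prop) :
  (forall t, 0 <= t -> t <= T -> (forall s, s \in S -> 0 <= s -> s < t -> A s) ->
     A t) ->
  forall t, 0 <= t -> t <= T -> A t.
Proof.
move=> step t; have [n] := ubnP (count (fun s => s < t) S).
elim: n t => // n IH t ltn t0 tT; apply: step => // s sS s0 st.
apply: IH => //; last exact: le_trans (ltW st) tT.
rewrite ltnS in ltn; apply: leq_trans ltn.
have /perm_to_rem pS := sS.
rewrite !(permP pS)/= ltxx st add0n add1n ltnS.
by apply: sub_count => r /= rs; exact: lt_trans rs st.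
Qed.

(** The right endpoint is excluded because the input may jump at a sample taken there. *)
Definition piecewise_cst (T : R) S (v : R -> R) := forall a b,
  0 <= a -> a < b -> b <= T -> misses S a b ->
  exists c, forall s, a <= s < b -> v s = c.

Lemma piecewise_cst_measurable (T : R) S (v : R -> R) a b : piecewise_cst T S v ->
  0 <= a -> a <= b -> b <= T -> measurable_fun `[a, b] v.
Proof.
move=> vS; move: a b.
apply: (@itv_split_ind T S (fun a b => measurable_fun `[a, b] v)).
  move=> a b c a0 ab bc cT mab mbc.
  rewrite (_ : `[a, c]%classic = `[a, b]%classic `|` `[b, c]%classic).
    by apply/measurable_funU.
  apply/seteqP; split => r /=; rewrite !in_itv/=.
    by move=> /andP[ar rc]; have [rb|br] := leP r b; [left|right]; rewrite ?ar ?rc ?ltW.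
  by move=> [/andP[ar rb]|/andP[br rc]]; rewrite ?ar ?rc ?andbT;
    [exact: le_trans (ltW bc)|exact: le_trans (ltW ab) br].
move=> a b a0; rewrite le_eqVlt => /predU1P[<- _ _|ab bT mS].
  by rewrite set_itv1; exact: measurable_fun_set1.
have [c vc] := vS _ _ a0 ab bT mS.
(* The value at the endpoint [b] is unconstrained, so the singleton is split off. *)
rewrite -(@setUitv1 _ _ _ _ true) ?bnd_simp ?ltW//; apply/measurable_funU => //; split.
  apply: (eq_measurable_fun (cst c)) => [s|]; last exact: measurable_cst.
  by rewrite inE/= in_itv/= => /vc ->.
exact: measurable_fun_set1.
Qed.

Lemma lebesgue_measure_segment_lty a b :
  (@lebesgue_measure R `[a, b]%classic < +oo)%E.
Proof.
by rewrite lebesgue_measure_itv/= lte_fin; case: ifP => _; rewrite -?EFinB ltry.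
Qed.

Lemma piecewise_cst_integrable (T B : R) S (v : R -> R) a b : piecewise_cst T S v ->
  (forall s, 0 <= s -> `|v s| <= B) ->
  0 <= a -> a <= b -> b <= T ->
  (@lebesgue_measure R).-integrable `[a, b] (EFin \o v).
Proof.
move=> vS vB a0 ab bT; apply: measurable_bounded_integrable => //.
- exact: lebesgue_measure_segment_lty.
- exact: piecewise_cst_measurable vS _ _ _.
- exists B; split; first exact: num_real.
  move=> M BM r /=; rewrite in_itv/= => /andP[ar _].
  by rewrite (le_trans (vB _ (le_trans a0 ar)))// ltW.
Qed.

Lemma leb_intB (v : R -> R) a b : 0 <= a -> a <= b ->
  (@lebesgue_measure R).-integrable `[0, b] (EFin \o v) ->
  leb_int 0 b v - leb_int 0 a v = leb_int a b v.
Proof.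
move=> a0 ab iv; rewrite /leb_int Rintegral_itvB ?bnd_simp//.
rewrite Rintegral_itv_obnd_cbnd//; apply: integrableS iv => //.
by apply: subset_itv; rewrite bnd_simp.
Qed.

Lemma leb_int_cst (v : R -> R) a b c : a <= b ->
  (@lebesgue_measure R).-integrable `[a, b] (EFin \o v) ->
  (forall s, a <= s < b -> v s = c) -> leb_int a b v = c * (b - a).
Proof.
move=> ab iv vc; rewrite /leb_int -Rintegral_itv_bndo_bndc; last first.
  by apply: integrableS iv => //; apply: subset_itv; rewrite bnd_simp.
rewrite (@eq_Rintegral _ _ _ _ _ (cst c)); last first.
  by move=> s; rewrite inE/= in_itv/= => /vc.
rewrite Rintegral_cst//= lebesgue_measure_itv/= lte_fin.
by move: ab; rewrite le_eqVlt => /predU1P[->|->//]; rewrite ltxx subrr.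
Qed.

Lemma leb_int_bound (v : R -> R) a b M : a <= b ->
  (@lebesgue_measure R).-integrable `[a, b] (EFin \o v) ->
  (forall s, a <= s <= b -> `|v s| <= M) -> `|leb_int a b v| <= M * (b - a).
Proof.
move=> ab iv vM; rewrite /leb_int.
apply: (le_trans (le_normr_Rintegral _ iv)) => //.
have -> : M * (b - a) = \int[lebesgue_measure]_(x in `[a, b]) M.
  rewrite Rintegral_cst//= lebesgue_measure_itv/= lte_fin.
  by move: ab; rewrite le_eqVlt => /predU1P[->|->//]; rewrite ltxx subrr.
apply: le_Rintegral => //; first exact: integrable_norm.
  apply: measurable_bounded_integrable => //.
    exact: lebesgue_measure_segment_lty.
  by exists `|M|; split => // K MK r _ /=; rewrite ltW.
Qed.

End Pieces.

(** * Derivatives *)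

Section Calculus.
Context {R : realType}.

(** By the mean value theorem, both [g + f] and [g - f] are nondecreasing from [a] to [b]. *)
Lemma is_derive_increment_le (f df g dg : R -> R) (a b : R) : a <= b ->
  (forall s, is_derive s (1 : R) f (df s)) ->
  (forall s, is_derive s (1 : R) g (dg s)) ->
  (forall s, a < s < b -> `|df s| <= dg s) -> `|f b - f a| <= g b - g a.
Proof.
rewrite le_eqVlt => /predU1P[->|ab]; first by rewrite !subrr normr0.
move=> dfE dgE dle.
have mono (h dh : R -> R) : (forall s, is_derive s (1 : R) h (dh s)) ->
    (forall s, a < s < b -> 0 <= dh s) -> h a <= h b.
  move=> dhE dh0; rewrite -subr_ge0.
  have hcont : {within `[a, b], continuous h}.
    by apply: derivable_within_continuous => s _; apply: ex_derive.
  have [c] := MVT ab (fun s _ => dhE s) hcont.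
  by rewrite in_itv/= => cab ->; rewrite mulr_ge0 ?dh0// subr_ge0 ltW.
have := mono _ _ (fun s => is_deriveB (dgE s) (dfE s)).
have := mono _ _ (fun s => is_deriveD (dgE s) (dfE s)).
rewrite /= !fctE => hD hB; rewrite ler_norml; apply/andP; split.
- have : g a + f a <= g b + f b; last by lra.
  by apply: hD => s /dle; rewrite ler_norml => /andP[]; lra.
- have : g a - f a <= g b - f b; last by lra.
  by apply: hB => s /dle; rewrite ler_norml => /andP[]; lra.
Qed.

Lemma is_derive_scaled_expR (c k s : R) :
  is_derive s (1 : R) (fun r => c * expR (k * r)) (c * (k * expR (k * s))).
Proof.
have dlin : is_derive s (1 : R) (fun r : R => k * r) k.
  apply: (is_derive_eq (is_deriveZ k (is_derive_id s (1 : R)))).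
  by rewrite /GRing.scale/= mulr1.
have dexp := is_derive1_comp (is_derive_expR (k * s)) dlin.
apply: (is_derive_eq (is_deriveZ c dexp)).
by rewrite /GRing.scale/= (mulrC k (expR _)).
Qed.

Lemma is_derive_affine (y c a s : R) :
  is_derive s (1 : R) (fun r : R => y + c * (r - a)) c.
Proof.
have d1 := is_deriveB (is_derive_id s (1 : R)) (is_derive_cst a s (1 : R)).
have d2 := is_deriveD (is_derive_cst y s (1 : R)) (is_deriveZ c d1).
apply: (is_derive_eq d2).
by rewrite /GRing.scale/= subr0 mulr1 add0r.
Qed.

Lemma is_derive_mexp_shift n (A : 'M[R]_n) i j (T s : R) :
  is_derive s (1 : R) (fun r => mexp ((r - T) *: A) i j)
    ((mexp ((s - T) *: A) *m A) i j).
Proof.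
have d1 : is_derive s (1 : R) (fun r : R => r - T) 1.
  apply: (is_derive_eq (is_deriveB (is_derive_id s (1 : R))
    (is_derive_cst T s (1 : R)))).
  by rewrite subr0.
apply: (is_derive_eq (@is_derive1_comp R (fun y => mexp (y *: A) i j)
  (fun r => r - T) s _ _ (is_derive_mexp A i j (s - T)) d1)).
by rewrite mulr1.
Qed.

End Calculus.

(** * Laplacian flow *)

Section Laplacian.
Context {R : realType} {N : nat} (adj : rel 'I_N).
Hypothesis adjG : undirected_graph adj.

Definition lap (z : 'I_N -> R) i := \sum_(j | adj i j) (z i - z j).

Lemma sum_adj_const i (c : R) : \sum_(j | adj i j) c = (deg adj i)%:R * c.
Proof.
rewrite sumr_const mulr_natl; congr (c *+ _); rewrite /deg; apply: eq_card => j.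
by apply/idP/idP; rewrite inE.
Qed.

Lemma laplacian_mul (z : 'I_N -> R) i : \sum_j laplacian R adj i j * z j = lap z i.
Proof.
have [_ irr] := adjG.
rewrite /lap sumrB sum_adj_const (bigD1 i)//= mxE eqxx; congr (_ + _).
rewrite -sumrN [RHS]big_mkcond/= [RHS](bigD1 i)//= (negbTE (irr i)) add0r.
apply: eq_bigr => j ji; rewrite mxE eq_sym (negbTE ji).
by case: ifP => _; rewrite ?mulN1r ?mul0r.
Qed.

Lemma sum_lap (z : 'I_N -> R) : \sum_i lap z i = 0.
Proof.
have [sym _] := adjG.
rewrite /lap; under eq_bigr do rewrite sumrB; rewrite sumrB; apply/eqP.
rewrite subr_eq0 [X in _ == X](exchange_big_dep predT)//=; apply/eqP.
by apply: eq_bigr => i _; apply: eq_bigl => j; rewrite sym.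
Qed.

(** The entries of [L z] sum to zero, so [avg_mx] annihilates it and may be subtracted for free.
    This brings in the matrix whose norm decays. *)
Lemma mul_laplacian_lap (M : 'M[R]_N) (z : 'I_N -> R) i :
  \sum_j (M *m laplacian R adj) i j * z j = \sum_j (M - avg_mx R N) i j * lap z j.
Proof.
transitivity (\sum_j M i j * lap z j); last first.
  under [RHS]eq_bigr do rewrite !mxE mulrBl.
  by rewrite sumrB -mulr_sumr sum_lap mulr0 subr0.
under eq_bigr do rewrite mxE mulr_suml.
rewrite exchange_big/=; apply: eq_bigr => l _; rewrite -laplacian_mul mulr_sumr.
by apply: eq_bigr => j _; rewrite mulrA.
Qed.

(** The Laplacian produced by the exponential joins the velocity [c], leaving [L y + c]: along the
    closed loop, the input error. *)
Lemma deviation_derive (z c : 'I_N -> R) (a T s : R) i :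
  let y j r := z j + c j * (r - a) in
  is_derive s (1 : R)
    (fun r => \sum_j (mexp ((r - T) *: laplacian R adj) - avg_mx R N) i j * y j r)
    (\sum_j (mexp ((s - T) *: laplacian R adj) - avg_mx R N) i j *
       (lap (y^~ s) j + c j)).
Proof.
move=> y; set L := laplacian R adj.
pose w j r := mexp ((r - T) *: L) i j - avg_mx R N i j.
have wE j r : (mexp ((r - T) *: L) - avg_mx R N) i j = w j r.
  by rewrite mxE; congr (_ + _); rewrite mxE.
have d j : is_derive s (1 : R) (fun r => w j r * y j r)
    ((mexp ((s - T) *: L) *m L) i j * y j s + w j s * c j).
  have dw := is_deriveB (is_derive_mexp_shift L i j T s)
    (is_derive_cst (avg_mx R N i j) s (1 : R)).
  have dy := is_derive_affine (z j) (c j) a s.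
  apply: (is_derive_eq (is_deriveM dw dy)).
  by rewrite subr0 /GRing.scale/= addrC [X in X + _]mulrC.
rewrite (_ : (fun r => _) = \sum_j (fun r => w j r * y j r)); last first.
  by apply/funext => r; rewrite fct_sumE; apply: eq_bigr => j _; rewrite wE.
apply: (is_derive_eq (is_derive_sum d)).
rewrite big_split/= mul_laplacian_lap -big_split/=.
by apply: eq_bigr => j _; rewrite wE mulrDr.
Qed.

(* [sup] of an unbounded set is [0], so positivity of [Gamma_inf] makes it finite. *)
Lemma Gamma_inf_bound (gamma t : R) i : 0 < Gamma_inf (laplacian R adj) gamma ->
  0 <= t -> \sum_j `|(mexp ((- t) *: laplacian R adj) - avg_mx R N) i j| <=
    Gamma_inf (laplacian R adj) gamma * expR (- (gamma * t)).
Proof.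
rewrite /Gamma_inf; set A := [set r | _]; move=> G0 t0.
have supA : has_sup A.
  by apply: contrapT => /sup_out A0; rewrite A0 ltxx in G0.
set W := mexp _ - _.
have At : A (mxnorm_inf (expR (gamma * t) *: W)) by exists t.
have := le_trans (ler_sum_mxnorm_inf _ i) (sup_upper_bound supA At).
under eq_bigr do rewrite mxE normrM (ger0_norm (expR_ge0 _)).
by rewrite -mulr_sumr mulrC -ler_pdivlMr ?expR_gt0// expRN.
Qed.

End Laplacian.

(** * Sampling times *)

Section SamplingTimes.
Context {R : realType} (tau : nat -> R) (tmin tmax : R).
Hypotheses (tmin0 : 0 < tmin) (tau0 : tau 0 = 0).
Hypothesis step : forall k, tmin <= tau k.+1 - tau k <= tmax.

Lemma tau_ge k : k%:R * tmin <= tau k.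
Proof.
elim: k => [|k IH]; first by rewrite mul0r tau0.
by have /andP[h _] := step k; rewrite -natr1 mulrDl mul1r; lra.
Qed.

Lemma tau_ge0 k : 0 <= tau k.
Proof. by apply: le_trans (tau_ge k); rewrite mulr_ge0// ltW. Qed.

(** The positive dwell time [tmin] rules out accumulation of samples. *)
Lemma tau_unbounded t : exists K, forall k, (K <= k)%N -> t < tau k.
Proof.
exists (Num.bound (`|t| / tmin)) => k Kk.
have := @archi_boundP R (`|t| / tmin).
rewrite divr_ge0 ?normr_ge0 ?(ltW tmin0)// => /(_ isT).
rewrite ltr_pdivrMr// => tlt; apply: (le_lt_trans (ler_norm _)).
apply: (lt_le_trans tlt); apply: le_trans (tau_ge k).
by rewrite ler_pM2r// ler_nat.
Qed.

Lemma tau_locate t : 0 <= t -> exists k, tau k <= t < tau k.+1.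
Proof.
move=> t0; have [K /(_ K (leqnn _)) tK] := tau_unbounded t.
have exP : exists k, t < tau k by exists K.
case: (ex_minnP exP) => -[|k] tk min; first by rewrite tau0 ltNge t0 in tk.
by exists k; rewrite tk andbT leNgt; apply/negP => /min; rewrite ltnn.
Qed.

End SamplingTimes.

(** * Closed loop *)

Section Trajectory.
Context {R : realType} {N : nat} (adj : rel 'I_N) (R0 : nat).
Context (Gam gamma E0 omega : R) (x0 delta taumin taumax : 'I_N -> R).
Context (x u : 'I_N -> R -> R) (tk : 'I_N -> nat -> R).
Hypothesis adjG : undirected_graph adj.
Hypotheses (Gam_gt0 : 0 < Gam) (E0_gt0 : 0 < E0) (omega_gt0 : 0 < omega).
Hypothesis delta_gt0 : forall i, 0 < delta i.
Hypothesis taumin_gt0 : forall i, 0 < taumin i.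
Hypothesis taumin_tilde : forall i, taumin i <= tilde_taumin adj omega delta taumax i.
Hypothesis taumin_max : forall i, taumin i <= taumax i.
Hypothesis traj :
  is_trajectory adj R0 Gam E0 omega x0 delta taumin taumax x u tk.

Local Notation E := (Erange Gam E0 omega).
Local Notation mu := (@lebesgue_measure R).

Lemma Erange_gt0 t : 0 < E t.
Proof. by rewrite /Erange !mulr_gt0// expR_gt0. Qed.

Lemma Erange_shift s r : E s * expR (omega * r) = E (s - r).
Proof. by rewrite /Erange -mulrA -expRD; congr (_ * expR _); ring. Qed.

Lemma Erange_anti s t : s <= t -> E t <= E s.
Proof.
move=> st; rewrite /Erange ler_pM2l ?mulr_gt0// ler_expR lerN2.
by rewrite ler_wpM2l// ltW.
Qed.

Definition sampled_input i k :=
  \sum_(j | adj i j) quant R0 (E (tk i k)) (x i (tk i k) - x j (tk i k)).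

Definition input_drift i k tau :=
  \sum_(j | adj i j) leb_int (tk i k) (tk i k + tau) (fun s => u i s - u j s).

Lemma inter_sampling_time i k : exists r,
  [/\ tk i k.+1 = tk i k + r, taumin i <= r <= taumax i &
      forall tau, taumin i <= tau < r ->
        `|input_drift i k tau| <= delta i * E (tk i k + tau)].
Proof.
have [_ _ _ /(_ i k)] := traj.
set A := [set tau : R | _]; set m := Order.min _ _ => tkS.
have infge : ((taumin i)%:E <= ereal_inf [set tau%:E | tau in A])%E.
  by apply/ereal_infP => _ [tau [tau_ge _] <-]; rewrite lee_fin.
have mge : ((taumin i)%:E <= m)%E by rewrite le_min infge lee_fin taumin_max.
have mle : (m <= (taumax i)%:E)%E by rewrite ge_min lexx orbT.
have minf : (m <= ereal_inf [set tau%:E | tau in A])%E by rewrite ge_min lexx.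
(* Both bounds are finite, so the minimum is a real number and [fine] returns the actual waiting
   time. *)
case: m tkS mge mle minf => [r| |]//= tkS; rewrite ?lee_fin => rge rle rinf.
exists r; split => //; first by rewrite rge rle.
move=> tau /andP[tau_ge taur]; rewrite leNgt; apply/negP => fgt.
have : A tau by split => //; exact: ltW.
move=> Atau; have := le_trans rinf (ereal_inf_lbound (ex_intro2 _ _ tau Atau erefl)).
by rewrite lee_fin leNgt taur.
Qed.

Lemma tk0 i : tk i 0 = 0.
Proof. by have [_ _ ->] := traj. Qed.

Lemma tk_gap i k : taumin i <= tk i k.+1 - tk i k <= taumax i.
Proof. by have [r [-> ? _]] := inter_sampling_time i k; rewrite addrC addKr. Qed.

Lemma tk_ge0 i k : 0 <= tk i k.
Proof. exact: (tau_ge0 (taumin_gt0 i) (tk0 i) (tk_gap i)). Qed.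

Lemma tk_locate i t : 0 <= t -> exists k, tk i k <= t < tk i k.+1.
Proof. exact: (tau_locate (taumin_gt0 i) (tk0 i) (tk_gap i)). Qed.

Lemma input_sampled i k s : tk i k <= s < tk i k.+1 -> u i s = - sampled_input i k.
Proof. by have [_ + _ _] := traj; apply. Qed.

Lemma sampled_input_bound i k : `|sampled_input i k| <= (deg adj i)%:R * E (tk i k).
Proof.
rewrite -sum_adj_const; apply: (le_trans (ler_norm_sum _ _ _)).
by apply: ler_sum => j _; rewrite quant_bound// Erange_gt0.
Qed.

Lemma Erange_tk_le i k s : tk i k <= s < tk i k.+1 ->
  E (tk i k) <= E s * expR (omega * taumax i).
Proof.
move=> /andP[_ sk]; rewrite Erange_shift; apply: Erange_anti.
have /andP[_ gap] := tk_gap i k.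
by rewrite lerBlDr (le_trans (ltW sk))// addrC -lerBlDr.
Qed.

Lemma input_bound i s : 0 <= s ->
  `|u i s| <= (deg adj i)%:R * expR (omega * taumax i) * E s.
Proof.
move=> s0; have [k sk] := tk_locate i s0.
rewrite (input_sampled sk) normrN (le_trans (sampled_input_bound _ _))//.
by rewrite -mulrA ler_wpM2l// mulrC Erange_tk_le.
Qed.

Lemma sampling_times_before T :
  exists S : seq R, forall i k, tk i k <= T -> tk i k \in S.
Proof.
pose K i := cid (tau_unbounded (taumin_gt0 i) (tk0 i) (tk_gap i) T).
have KT i k : tk i k <= T -> (k < sval (K i))%N.
  by rewrite leNgt ltnNge; apply: contraNN; exact: (svalP (K i)).
exists [seq tk i k | i <- enum 'I_N, k <- iota 0 (sval (K i))].
move=> i k /KT kK; apply/allpairsPdep; exists i, k.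
by rewrite mem_enum mem_iota.
Qed.

Lemma input_cst_misses T S i a b : (forall k, tk i k <= T -> tk i k \in S) ->
  0 <= a -> a < b -> b <= T -> misses S a b ->
  forall s, a <= s < b -> u i s = u i a.
Proof.
move=> hS a0 ab bT /allP mS s /andP[as_ sb].
have [k /andP[ka ak]] := tk_locate i a0.
(* A next sample before [b] would be a point of [S] inside [(a, b)]. *)
have bk : b <= tk i k.+1.
  rewrite leNgt; apply/negP => kb.
  by have := mS _ (hS _ (ltW (lt_le_trans kb bT))); rewrite ak kb.
rewrite !(@input_sampled i k)// ?ka ?ak//.
by rewrite (le_trans ka as_) (lt_le_trans sb bk).
Qed.

Lemma input_piecewise_cst T S i : (forall k, tk i k <= T -> tk i k \in S) ->
  piecewise_cst T S (u i).
Proof.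
move=> hS a b a0 ab bT mS; exists (u i a); exact: (input_cst_misses hS a0 ab bT mS).
Qed.

Lemma input_integrable i a b : 0 <= a -> a <= b -> mu.-integrable `[a, b] (EFin \o u i).
Proof.
move=> a0 ab; have [S hS] := sampling_times_before b.
apply: (@piecewise_cst_integrable _ b
  ((deg adj i)%:R * expR (omega * taumax i) * E 0) S) => //.
  by apply: input_piecewise_cst => k; exact: hS.
move=> s s0; rewrite (le_trans (input_bound i s0))// ler_wpM2l ?Erange_anti//.
Qed.

Lemma state_increment i a b : 0 <= a -> a <= b -> x i b - x i a = leb_int a b (u i).
Proof.
move=> a0 ab; have [xE _ _ _] := traj.
rewrite !xE ?(le_trans a0 ab)// -(@leb_intB _ (u i) a b)//; first by ring.
exact: input_integrable (lexx _) (le_trans a0 ab).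
Qed.

Lemma input_drift_lap i k tau : 0 <= tau ->
  input_drift i k tau =
  lap adj (x^~ (tk i k + tau)) i - lap adj (x^~ (tk i k)) i.
Proof.
move=> tau0; rewrite /input_drift /lap -sumrB; apply: eq_bigr => j _.
have t0 := tk_ge0 i k.
have le1 : tk i k <= tk i k + tau by rewrite lerDl.
rewrite /leb_int RintegralB//; try exact: input_integrable.
by rewrite -!/(leb_int _ _ _) -!state_increment//; ring.
Qed.

(** With [D] the bracketed sum, [tilde_taumin] solves [tau * D = delta i * expR (- omega tau)] when
    [D > 0]; monotonicity of [x * expR x] covers all smaller [tau]. *)
Lemma taumin_bound i tau : 0 <= tau -> tau <= taumin i ->
  tau * ((deg adj i)%:R ^+ 2 +
     \sum_(j | adj i j) (deg adj j)%:R * expR (omega * taumax j)) <=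
  delta i * expR (- (omega * tau)).
Proof.
move=> tau0 taule; set D := _ + _.
have D0 : 0 <= D.
  by rewrite addr_ge0 ?exprn_ge0// sumr_ge0// => j _; rewrite mulr_ge0// expR_ge0.
have := taumin_tilde i; rewrite /tilde_taumin -/D => tilde.
(* If [D = 0] the left side vanishes and the formula with [W] is not invoked. *)
move: D0; rewrite le_eqVlt => /predU1P[<-|D0].
  by rewrite mulr0 mulr_ge0 ?expR_ge0// ltW.
have [W0 WE] := @lambertWP R (omega * delta i / D)
  (divr_ge0 (mulr_ge0 (ltW omega_gt0) (ltW (delta_gt0 i))) (ltW D0)).
have tauW : omega * tau <= lambertW (omega * delta i / D).
  have := le_trans taule tilde.
  by rewrite mulrC ler_pdivlMr// mulrC.
have := ler_mul_expR (mulr_ge0 (ltW omega_gt0) tau0) tauW.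
rewrite WE ler_pdivlMr// -!mulrA ler_pM2l// => h.
by rewrite expRN ler_pdivlMr ?expR_gt0// -mulrA [D * _]mulrC.
Qed.

(** Before [taumin i] the trigger is not monitored, so the bound comes from input sizes. Agent [i]
    holds an input scaled by [E (tk i k)]; neighbours may still hold older samples with a larger
    range, whence the factors [expR (omega * taumax j)]. *)
Lemma input_drift_early i k tau : 0 <= tau -> tau <= taumin i ->
  tau < tk i k.+1 - tk i k ->
  `|input_drift i k tau| <= delta i * E (tk i k + tau).
Proof.
move=> tau0 taule taugap; have t0 := tk_ge0 i k.
have le1 : tk i k <= tk i k + tau by rewrite lerDl.
have incr_le j M : (forall s, tk i k <= s <= tk i k + tau -> `|u j s| <= M) ->
    `|x j (tk i k + tau) - x j (tk i k)| <= M * tau.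
  move=> uM; rewrite state_increment//.
  have -> : M * tau = M * (tk i k + tau - tk i k) by ring.
  by apply: leb_int_bound => //; exact: input_integrable.
have own : `|x i (tk i k + tau) - x i (tk i k)| <= (deg adj i)%:R * E (tk i k) * tau.
  apply: incr_le => s /andP[ks sk].
  rewrite (@input_sampled i k) ?normrN ?sampled_input_bound// ks/=.
  by apply: (le_lt_trans sk); rewrite addrC -ltrBrDr.
have other j : `|x j (tk i k + tau) - x j (tk i k)| <=
    (deg adj j)%:R * expR (omega * taumax j) * E (tk i k) * tau.
  apply: incr_le => s /andP[ks _].
  apply: (le_trans (input_bound j (le_trans t0 ks))).
  by rewrite ler_wpM2l ?Erange_anti// mulr_ge0// expR_ge0.
rewrite input_drift_lap// /lap -sumrB.
apply: (le_trans (ler_norm_sum _ _ _)).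
apply: (@le_trans _ _ (\sum_(j | adj i j) ((deg adj i)%:R * E (tk i k) * tau +
    (deg adj j)%:R * expR (omega * taumax j) * E (tk i k) * tau))).
  apply: ler_sum => j _; apply: le_trans (lerD own (other j)).
  rewrite [X in `|X|](_ : _ = (x i (tk i k + tau) - x i (tk i k)) -
      (x j (tk i k + tau) - x j (tk i k))); last by ring.
  exact: ler_normB.
rewrite big_split/= sum_adj_const -!mulr_suml.
have -> : E (tk i k + tau) = E (tk i k) * expR (- (omega * tau)).
  by rewrite -mulrN Erange_shift opprK.
have := ler_wpM2l (ltW (Erange_gt0 (tk i k))) (taumin_bound tau0 taule).
by congr (_ <= _); ring.
Qed.

(** Up to [taumin i] the a priori bound applies; afterwards the trigger has not fired before the
    next sample. *)
Lemma lap_drift i k s : tk i k <= s < tk i k.+1 ->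
  `|lap adj (x^~ s) i - lap adj (x^~ (tk i k)) i| <= delta i * E s.
Proof.
move=> /andP[ks sk]; have tau0 : 0 <= s - tk i k by rewrite subr_ge0.
have sE : s = tk i k + (s - tk i k) by rewrite addrC subrK.
rewrite sE -input_drift_lap//.
have [early|late] := leP (s - tk i k) (taumin i).
  by apply: input_drift_early => //; rewrite ltrD2r.
have [r [tkS _]] := inter_sampling_time i k; apply; rewrite (ltW late)/=.
by move: sk; rewrite tkS; lra.
Qed.

Lemma input_error i k s : tk i k <= s < tk i k.+1 ->
  (forall j, adj i j -> `|x i (tk i k) - x j (tk i k)| <= E (tk i k)) ->
  `|lap adj (x^~ s) i + u i s| <=
  (delta i + (deg adj i)%:R * expR (omega * taumax i) / (2 * R0 + 1)%:R) * E s.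
Proof.
move=> sk unsat; rewrite (input_sampled sk).
(* Drift since the sample plus quantization error at the sample. *)
have -> : lap adj (x^~ s) i - sampled_input i k =
    (lap adj (x^~ s) i - lap adj (x^~ (tk i k)) i) +
    (lap adj (x^~ (tk i k)) i - sampled_input i k) by ring.
apply: (le_trans (ler_normD _ _)); rewrite mulrDl; apply: lerD.
  exact: lap_drift.
rewrite /lap /sampled_input -sumrB.
apply: (@le_trans _ _ ((deg adj i)%:R * (E (tk i k) / (2 * R0 + 1)%:R))).
  rewrite -sum_adj_const; apply: (le_trans (ler_norm_sum _ _ _)).
  by apply: ler_sum => j ij; rewrite quant_err ?Erange_gt0 ?unsat.
have -> : (deg adj i)%:R * expR (omega * taumax i) / (2 * R0 + 1)%:R * E s =
  (deg adj i)%:R * (E s * expR (omega * taumax i) / (2 * R0 + 1)%:R) by ring.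
by rewrite ler_wpM2l// ler_wpM2r ?invr_ge0// Erange_tk_le.
Qed.

Lemma state_affine_misses T S i a b : (forall k, tk i k <= T -> tk i k \in S) ->
  0 <= a -> a < b -> b <= T -> misses S a b ->
  forall s, a <= s <= b -> x i s = x i a + u i a * (s - a).
Proof.
move=> hS a0 ab bT mS s /andP[as_ sb].
have ucst := input_cst_misses hS a0 ab bT mS.
rewrite -(@leb_int_cst _ (u i) a s (u i a))//; first by rewrite -state_increment//; ring.
  exact: input_integrable.
by move=> r /andP[ar rs]; rewrite ucst// ar (lt_le_trans rs sb).
Qed.

(* Variation of constants without integrals: [phi s] below interpolates between
   the quantity to bound at [s = T] and the initial deviation at [s = 0], and its
   derivative only involves the input error. *)
Lemma deviation_decay T m i : 0 <= T ->
  (forall t l, 0 <= t ->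
     \sum_j `|(mexp ((- t) *: laplacian R adj) - avg_mx R N) l j| <=
     Gam * expR (- (gamma * t))) ->
  (forall s j, 0 <= s < T -> `|lap adj (x^~ s) j + u j s| <=
     (gamma - omega) * (E0 * expR (- (omega * s)))) ->
  (forall j, `|x j 0 - m| <= E0) ->
  `|\sum_j (1%:M - avg_mx R N) i j * (x j T - m)| <= Gam * E0 * expR (- (omega * T)).
Proof.
move=> T0 mexp_le err_le init_le.
set L := laplacian R adj.
have [S hS] := sampling_times_before T.
pose W s := mexp ((s - T) *: L) - avg_mx R N.
have W_le s : s <= T -> \sum_j `|W s i j| <= Gam * expR (- (gamma * (T - s))).
  move=> sT; have := mexp_le (T - s) i; rewrite subr_ge0 => /(_ sT).
  by rewrite opprB.
pose phi s := \sum_j W s i j * (x j s - m).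
(* Chosen so that [g T] is the target, [g 0] bounds the initial deviation, and its derivative is the
   kernel bound times the error bound. *)
pose g s := Gam * E0 * expR (- (gamma * T)) * expR ((gamma - omega) * s).
have incr : `|phi T - phi 0| <= g T - g 0.
  apply: (@itv_split_ind R T S (fun a b => `|phi b - phi a| <= g b - g a)) => //.
    move=> a b c _ _ _ _ hab hbc.
    have -> : phi c - phi a = (phi b - phi a) + (phi c - phi b) by ring.
    by apply: (le_trans (ler_normD _ _)); lra.
  move=> a b a0; rewrite le_eqVlt => /predU1P[->|ab] bT mS.
    by rewrite !subrr normr0.
  (* The state is smooth only piecewise; on an interval without interior samples it agrees with this
     globally differentiable affine function. *)
  pose y j r := (x j a - m) + u j a * (r - a).
  have yE j s : a <= s <= b -> y j s = x j s - m.
    move=> sab; rewrite (state_affine_misses (hS j) a0 ab bT mS sab) /y.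
    by ring.
  have phiE s : a <= s <= b -> phi s = \sum_j W s i j * y j s.
    by move=> sab; apply: eq_bigr => j _; rewrite yE.
  rewrite !phiE ?lexx ?(ltW ab)//.
  apply: (is_derive_increment_le (ltW ab)
    (fun s => deviation_derive adjG (fun j => x j a - m) (u^~ a) a T s i)
    (fun s => is_derive_scaled_expR _ (gamma - omega) s)).
  move=> s /andP[as_ sb].
  have sab : a <= s <= b by rewrite !ltW.
  have sT : s < T := lt_le_trans sb bT.
  have s0T : 0 <= s < T by rewrite (le_trans a0 (ltW as_)).
  rewrite -/L -/(W s).
  have errE j : lap adj (y^~ s) j + u j a = lap adj (x^~ s) j + u j s.
    congr (_ + _); last first.
      by rewrite (input_cst_misses (hS j) a0 ab bT mS)// sb ltW.
    by apply: eq_bigr => l _; rewrite !yE//; ring.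
  apply: (le_trans (ler_norm_sum _ _ _)).
  apply: (@le_trans _ _
    (\sum_j `|W s i j| * ((gamma - omega) * (E0 * expR (- (omega * s)))))).
    apply: ler_sum => j _; rewrite normrM ler_wpM2l//.
    by rewrite -/(y _ s) errE err_le.
  rewrite -mulr_suml.
  apply: (@le_trans _ _ (Gam * expR (- (gamma * (T - s))) *
      ((gamma - omega) * (E0 * expR (- (omega * s)))))).
    (* The factor with [gamma - omega] is nonnegative because it bounds an absolute value. *)
    apply: ler_wpM2r; last exact/W_le/ltW.
    exact: le_trans (err_le s i s0T).
  have -> : expR ((gamma - omega) * s) = expR (gamma * s) * expR (- (omega * s)).
    by rewrite -expRD; congr expR; ring.
  have -> : expR (- (gamma * (T - s))) = expR (- (gamma * T)) * expR (gamma * s).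
    by rewrite -expRD; congr expR; ring.
  by rewrite le_eqVlt; apply/orP; left; apply/eqP; ring.
have phi0 : `|phi 0| <= g 0.
  apply: (le_trans (ler_norm_sum _ _ _)).
  apply: (@le_trans _ _ (\sum_j `|W 0 i j| * E0)).
    by apply: ler_sum => j _; rewrite normrM ler_wpM2l.
  rewrite -mulr_suml /g mulr0 expR0 mulr1 mulrAC ler_pM2r//.
  by rewrite -[X in gamma * X](subr0 T) W_le.
have <- : phi T = \sum_j (1%:M - avg_mx R N) i j * (x j T - m).
  by rewrite /phi /W subrr scale0r mexp0.
have <- : g T = Gam * E0 * expR (- (omega * T)).
  by rewrite /g -mulrA -expRD; congr (_ * expR _); ring.
have -> : phi T = phi 0 + (phi T - phi 0) by ring.
by apply: (le_trans (ler_normD _ _)); lra.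
Qed.

End Trajectory.

(** * Decay-rate condition and consensus *)

(** The hypothesis reads [W <= (eta - omega) * taumax i]. Applying the increasing map [x * expR x]
    and the equation of [W] gives [xi * expR (omega * taumax i) <= eta - omega], which is the claim
    rearranged. *)
Lemma tilde_omega_bound {R : realType} {N : nat} (adj : rel 'I_N) R0
    (Gam gamma omega : R) (delta taumax : 'I_N -> R) i :
  0 <= Gam -> 0 < taumax i ->
  omega <= tilde_omega_term adj R0 Gam gamma delta taumax i ->
  (delta i + (deg adj i)%:R * expR (omega * taumax i) / (2 * R0 + 1)%:R) * (2 * Gam)
    <= gamma - omega.
Proof.
move=> G0 t0; rewrite /tilde_omega_term/=.
set xi := 2 * Gam * _ / _; set eta := gamma - _; set W := lambertW _ => omle.
have xi0 : 0 <= xi by rewrite divr_ge0// !mulr_ge0.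
have [W0 WE] : 0 <= W /\ W * expR W = xi * taumax i * expR (eta * taumax i).
  by apply: lambertWP; rewrite !mulr_ge0// ?expR_ge0// ltW.
have Wle : W <= (eta - omega) * taumax i by rewrite -ler_pdivrMr//; lra.
have := ler_mul_expR W0 Wle; rewrite WE.
have -> : expR ((eta - omega) * taumax i) =
    expR (eta * taumax i) / expR (omega * taumax i).
  by rewrite -expRN -expRD; congr expR; ring.
rewrite mulrA ler_pdivlMr ?expR_gt0// mulrAC ler_pM2r ?expR_gt0//.
rewrite mulrAC ler_pM2r// => h.
rewrite [leLHS](_ : _ = 2 * Gam * delta i + xi * expR (omega * taumax i)).
  by move: h; rewrite /eta; lra.
by rewrite /xi; ring.
Qed.

Lemma centering_mul {R : realType} {N : nat} (z : 'I_N -> R) i :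
  \sum_j (1%:M - avg_mx R N) i j * z j = z i - N%:R^-1 * \sum_j z j.
Proof.
under eq_bigr do rewrite !mxE mulrBl.
rewrite sumrB -mulr_sumr; congr (_ - _).
rewrite (bigD1 i)//= eqxx mul1r big1 ?addr0// => j ji.
by rewrite eq_sym (negbTE ji) mul0r.
Qed.

Theorem theorem1 (R : realType) (N : nat) (adj : rel 'I_N) (R0 : nat)
    (gamma E0 omega : R) (x0 delta taumin taumax : 'I_N -> R)
    (x u : 'I_N -> R -> R) (tk : 'I_N -> nat -> R) :
  (2 <= N)%N ->
  undirected_graph adj -> connected_graph adj ->
  0 < gamma -> (exists l, is_lambda2 (laplacian R adj) l /\ gamma <= l) ->
  0 < E0 ->
  (forall i, `|x0 i - (N%:R)^-1 * \sum_(j < N) x0 j| <= E0) ->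
  (forall i, 0 < delta i) ->
  (forall i, 0 < taumax i) ->
  let Gam := Gamma_inf (laplacian R adj) gamma in
  (* (a) *)
  (forall i, delta i + (deg adj i)%:R / (2 * R0 + 1)%:R < gamma / (2 * Gam)) ->
  (* (b) *)
  (forall i, 0 < taumin i /\
     taumin i <= Num.min (tilde_taumin adj omega delta taumax i) (taumax i)) ->
  (* (c) : 0 < omega <= tilde omega = min_i (...) *)
  0 < omega ->
  (forall i, omega <= tilde_omega_term adj R0 Gam gamma delta taumax i) ->
  is_trajectory adj R0 Gam E0 omega x0 delta taumin taumax x u tk ->
  (forall i j k, adj i j ->
     `|x i (tk i k) - x j (tk i k)| <= Erange Gam E0 omega (tk i k)) /\
  (forall t, 0 <= t -> forall i j,
     `|x i t - x j t| <= 2 * Gam * E0 * expR (- (omega * t))).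
Proof.
move=> N2 adjG _ gamma_gt0 _ E0_gt0 x0_le delta_gt0 taumax_gt0 Gam cond_a cond_b
  omega_gt0 cond_c traj.
(* The left side of (a) is nonnegative, so [gamma / (2 * Gam)] is positive; as division by 0 gives
   0, this also excludes [Gam = 0]. *)
have Gam_gt0 : 0 < Gam.
  have a := cond_a (Ordinal (ltnW N2)).
  have : 0 < gamma / (2 * Gam).
    by apply: le_lt_trans a; rewrite addr_ge0 ?divr_ge0// ltW.
  by rewrite pmulr_rgt0// invr_gt0 pmulr_rgt0.
have taumin_gt0 i : 0 < taumin i by have [] := cond_b i.
have taumin_tilde i : taumin i <= tilde_taumin adj omega delta taumax i.
  by have [_] := cond_b i; rewrite le_min => /andP[].
have taumin_max i : taumin i <= taumax i.
  by have [_] := cond_b i; rewrite le_min => /andP[].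
have tkge0 := tk_ge0 taumin_gt0 taumin_max traj.
have x_init i : x i 0 = x0 i.
  by have [xE _ _ _] := traj; rewrite xE// /leb_int set_itv1 Rintegral_set1 addr0.
(* Unsaturation is the consensus bound read at a sampling time. *)
suff main t : 0 <= t -> forall i j,
    `|x i t - x j t| <= Erange Gam E0 omega t.
  by split => [i j k _|t t0 i j]; exact: main.
move=> t_ge0; have [S tk_S] :=
  sampling_times_before taumin_gt0 taumin_max traj t.
apply: (@strong_ind_before R t S
  (fun s => forall i j, `|x i s - x j s| <= Erange Gam E0 omega s)) => //.
move=> T T0 Tt unsat i j.
pose m := N%:R^-1 * \sum_(r < N) x0 r.
have dev l : `|\sum_r (1%:M - avg_mx R N) l r * (x r T - m)| <=
    Gam * E0 * expR (- (omega * T)).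
  apply: (deviation_decay (gamma := gamma) adjG Gam_gt0 E0_gt0 omega_gt0 taumin_gt0
    taumin_max traj) => // [s i' s0|s i' /andP[s0 sT]|j'].
  - exact: Gamma_inf_bound.
  - have [k sk] := tk_locate taumin_gt0 taumin_max traj i' s0.
    have /andP[ks _] := sk.
    apply: (le_trans (input_error Gam_gt0 E0_gt0 omega_gt0 delta_gt0
      taumin_gt0 taumin_tilde taumin_max traj sk _)).
      (* The sample governing time [s < T] was taken strictly before [T], so the induction
         hypothesis applies. *)
      move=> l' _; apply: unsat; rewrite ?tkge0 ?(le_lt_trans ks sT)//.
      by apply: tk_S; rewrite (le_trans ks)// (le_trans (ltW sT)).
    (* Multiplying by [E0 * expR (- (omega * s))] turns the factor [2 * Gam] into [E s]. *)
    have := tilde_omega_bound (ltW Gam_gt0) (taumax_gt0 i') (cond_c i').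
    move=> /(ler_wpM2r (ltW (mulr_gt0 E0_gt0 (expR_gt0 (- (omega * s)))))).
    by apply: le_trans; rewrite le_eqVlt /Erange; apply/orP; left; apply/eqP; ring.
  - by rewrite x_init.
(* Centering subtracts the same mean from both states, so the mean and [m] cancel. The two deviation
   bounds add up to exactly [E T]. *)
have -> : x i T - x j T = \sum_r (1%:M - avg_mx R N) i r * (x r T - m) -
    \sum_r (1%:M - avg_mx R N) j r * (x r T - m).
  by rewrite !centering_mul; ring.
apply: (le_trans (ler_normB _ _)); apply: (le_trans (lerD (dev i) (dev j))).
by rewrite /Erange; lra.
Qed.
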